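(* $\chi^\star_c(G) \le 2\delta^\star(G)$ for any graph $G$.
   Context: Graphs are finite and simple. The degeneracy $\delta^\star(G)$ is the maximum over all subgraphs $H$ of $G$ of the minimum degree of $H$; equivalently, it is the least $d$ such that the vertices of $G$ can be ordered so that each vertex has at most $d$ neighbours preceding it in the order. For a positive integer $k$, a $k$-fold correspondence-cover of $G$ via $L$ is a graph $H$ together with a mapping $L:V(G)\to 2^{V(H)}$ such that the sets $L(v)$, $v\in V(G)$, partition $V(H)$, $|L(v)|=k$ for every $v$, for every edge $vv'\in E(G)$ the edges of $H$ between $L(v)$ and $L(v')$ form a (possibly empty) matching, and for distinct nonadjacent $v,v'$ there is no edge of $H$ between $L(v)$ and $L(v')$. An independent transversal of $H$ with respect to $L$ (also called a correspondence $L$-colouring of $H$) is a set of vertices of $H$ consisting of exactly one vertex from each $L(v)$ that forms an independent set in $H$. A ($k$-fold) correspondence $L$-packing of $H$ is a collection of $k$ mutually disjoint correspondence $L$-colourings of $H$. The correspondence (chromatic) packing number $\chi^\star_c(G)$ is the least $k$ such that every $k$-fold correspondence-cover $H$ of $G$ via any $L$ admits a $k$-fold correspondence $L$-packing.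
   Formalization: The graph G is assumed to have at least one edge: for an edgeless graph the degeneracy is 0 while the correspondence packing number, a least positive k, is 1, so the stated inequality fails there. *)

(* Defs.v *)
From mathcomp Require Import all_boot.

Set Implicit Arguments.
Unset Strict Implicit.
Unset Printing Implicit Defensive.

Record sgraph := SGraph {
  vertex :> finType;
  adj : rel vertex;
  adj_sym : symmetric adj;
  adj_irrefl : irreflexive adj }.

Arguments adj {s} _ _.

(* A subgraph is a pair of a vertex set and an edge set, each edge uv being
   stored as the two ordered pairs (u, v) and (v, u). *)
Definition is_subgraph (G : sgraph) (H : {set G} * {set G * G}) : bool :=
  [forall u, forall v, ((u, v) \in H.2) ==>
     [&& u \in H.1, v \in H.1, adj u v & (v, u) \in H.2]].

Definition subgraph_degree (G : sgraph) (H : {set G} * {set G * G}) (v : G) :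
    nat :=
  #|[set u | (v, u) \in H.2]|.

(* The neutral element #|G| strictly exceeds every degree, so this is the
   minimum degree as soon as H has a vertex. *)
Definition subgraph_min_degree (G : sgraph) (H : {set G} * {set G * G}) : nat :=
  \big[minn/#|G|]_(v in H.1) subgraph_degree H v.

Definition degeneracy (G : sgraph) : nat :=
  \max_(H : {set G} * {set G * G} | is_subgraph H && (H.1 != set0))
     subgraph_min_degree H.

(* The edges of H with one end in A and the other in B are pairwise disjoint;
   used for disjoint A and B. *)
Definition matching_between (H : sgraph) (A B : {set H}) : Prop :=
  forall x x' y y' : H,
    x \in A -> x' \in A -> y \in B -> y' \in B ->
    adj x y -> adj x' y' -> (x = x' <-> y = y').

Record corr_cover (G H : sgraph) (L : G -> {set H}) (k : nat) : Prop := CorrCover {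
  cover_disjoint : forall u v : G, u != v -> [disjoint L u & L v];
  cover_full : \bigcup_(v : G) L v = [set: H];
  cover_card : forall v : G, #|L v| = k;
  cover_matching : forall u v : G, adj u v -> matching_between (L u) (L v);
  cover_nonadj : forall u v : G, u != v -> ~~ adj u v ->
    forall x y : H, x \in L u -> y \in L v -> ~~ adj x y }.

Definition corr_colouring (G H : sgraph) (L : G -> {set H}) (I : {set H}) :
    Prop :=
  (forall v : G, #|I :&: L v| = 1) /\ {in I &, forall x y, ~~ adj x y}.

Definition corr_packing (G H : sgraph) (L : G -> {set H}) (k : nat)
    (P : 'I_k -> {set H}) : Prop :=
  (forall i, corr_colouring L (P i)) /\
  (forall i j, i != j -> [disjoint P i & P j]).

Definition corr_packable (G : sgraph) (k : nat) : Prop :=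
  forall (H : sgraph) (L : G -> {set H}),
    corr_cover L k -> exists P : 'I_k -> {set H}, corr_packing L P.

(* The packing number is given by its graph, so that no default value has to be
   chosen before a packable k is known to exist. Only positive k are considered:
   every graph is trivially 0-packable. *)
Definition is_corr_packing_number (G : sgraph) (k : nat) : Prop :=
  [/\ 0 < k, corr_packable G k &
      forall j : nat, 0 < j -> corr_packable G j -> k <= j].

(* Main.v *)
Require Import Defs.
From mathcomp Require Import all_boot.
From mathcomp Require Import fingroup perm zify.
From Stdlib Require Import Classical.

Set Implicit Arguments.
Unset Strict Implicit.
Unset Printing Implicit Defensive.

(** Write [d] for the degeneracy.  Every cover with fibres of size [k >= 2 * d]
    has a packing, built greedily one vertex at a time: every nonempty vertex
    set has a vertex [v] with at most [d] neighbours in the set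
    ([exists_small_degree]), so [v] can be removed, the rest packed, and [v] put
    back last.

    To put [v] back is to match the [k] colourings with the [k] elements of
    [L v].  Each of the at most [d] neighbours [u] already coloured forbids the
    pairs (colouring, element of [L v]) for which the element is adjacent to the
    colour of [u].  The edges between [L u] and [L v] form a matching and the
    colourings use distinct colours at [u], so these pairs form a matching too.
    Hence every colouring and every element of [L v] is in at most
    [d] <= [k / 2] forbidden pairs.  A balanced bipartite graph in which every
    vertex is joined to at least half of the other side has a perfect matching
    ([perm_of_half_degrees]), which gives the extension.

    The degeneracy of a graph with an edge is positive, so [2 * d] is a positive
    candidate in the definition of the packing number. *)

(** The Dirac-type condition makes a single exchange enough: a permutation [s]
    satisfying [r i (s i)] for as many [i] as possible satisfies it for all.
    Suppose [r i (s i)] fails.  The [j] with [r i (s j)] and those with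
    [r j (s i)] are at least half of [T] each, and both sets miss [i], so they
    share some [j]; exchanging the values at [i] and [j] makes the relation
    hold at both and changes nothing elsewhere. *)
Lemma perm_of_half_degrees (T : finType) (r : rel T) :
    (forall i, #|T| <= 2 * #|[set j | r i j]|) ->
    (forall j, #|T| <= 2 * #|[set i | r i j]|) ->
  exists s : {perm T}, forall i, r i (s i).
Proof.
move=> out_half in_half.
pose good (s : {perm T}) := [set i | r i (s i)].
have [s _ s_max] := @arg_maxnP _ 1%g xpredT (fun s => #|good s|) isT.
exists s => i; apply/negPn/negP => bad_i.
pose A := [set j | r i (s j)]; pose B := [set j | r j (s i)].
have cardA : #|A| = #|[set j | r i j]|.
  rewrite -(card_imset _ (@perm_inj _ s)); apply: eq_card => x.
  rewrite inE; apply/imsetP/idP => [[y]|rix].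
    by rewrite !inE => riy ->.
  by exists ((s^-1)%g x); rewrite ?inE permKV.
have subAB : A :|: B \subset [set~ i].
  by apply/subsetP => j; rewrite !inE; case: eqP => // ->; rewrite orbb (negPf bad_i).
have [AB0|[j]] := set_0Vmem (A :&: B).
  have := subset_leq_card subAB; rewrite cardsU AB0 cards0 subn0 cardsC1 cardA.
  have := out_half i; have := in_half (s i); rewrite -/B.
  have : 0 < #|T| by apply/card_gt0P; exists i.
  lia.
rewrite !inE => /andP[rij rji].
suff : good s \proper good (tperm i j * s)%g.
  by move/proper_card; rewrite ltnNge => /negP[]; apply: s_max.
apply/properP; split; last first.
  by exists i; rewrite inE ?permM ?tpermL.
apply/subsetP => x; rewrite !inE permM.
by case: tpermP => [->|->|].
Qed.

Lemma card_bigcup_le1 (I T : finType) (N : {set I}) (F : I -> {set T}) :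
  (forall u, u \in N -> #|F u| <= 1) -> #|\bigcup_(u in N) F u| <= #|N|.
Proof.
move=> F1; rewrite -[leqRHS]sum1_card.
apply: (big_ind2 (fun (A : {set T}) m => #|A| <= m)) => [|A m B n Am Bn|//].
  by rewrite cards0.
by rewrite (leq_trans (leq_card_setU A B)) ?leq_add.
Qed.

Lemma perm_avoiding_matchings (I T : finType) (N : {set I})
    (R : I -> rel T) :
    2 * #|N| <= #|T| ->
    (forall u i i' j j', u \in N -> R u i j -> R u i' j' -> i = i' <-> j = j') ->
  exists s : {perm T}, forall i u, u \in N -> ~~ R u i (s i).
Proof.
move=> N_half matchR.
have half (F : I -> {set T}) (A : {set T}) :
    (forall u, u \in N -> #|F u| <= 1) -> A = ~: (\bigcup_(u in N) F u) ->
  #|T| <= 2 * #|A|.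
  move=> F1 ->; have := card_bigcup_le1 F1.
  have := cardsC (\bigcup_(u in N) F u); lia.
pose r i j := [forall u in N, ~~ R u i j].
have [||s sP] := @perm_of_half_degrees T r.
- move=> i; apply: (half (fun u => [set j | R u i j])) => [u uN|].
    apply/card_le1_eqP => j j'; rewrite !inE => Rj Rj'.
    by apply/esym/(matchR u i i).
  apply/setP => j; rewrite !inE; apply/forall_inP/negP => [free /bigcupP[u uN]|free u uN].
    by rewrite inE (negPf (free u uN)).
  by apply/negP => Ru; apply: free; apply/bigcupP; exists u; rewrite ?inE.
- move=> j; apply: (half (fun u => [set i | R u i j])) => [u uN|].
    apply/card_le1_eqP => i i'; rewrite !inE => Ri Ri'.
    by apply/esym/(matchR u i i' j j).
  apply/setP => i; rewrite !inE; apply/forall_inP/negP => [free /bigcupP[u uN]|free u uN].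
    by rewrite inE (negPf (free u uN)).
  by apply/negP => Ru; apply: free; apply/bigcupP; exists u; rewrite ?inE.
by exists s => i; apply/forall_inP/sP.
Qed.

(** The subgraph induced on [S] is one of those over which the degeneracy takes
    its maximum. *)
Lemma exists_small_degree (G : sgraph) (S : {set G}) :
  S != set0 ->
  exists2 v, v \in S & #|[set u in S | adj v u]| <= degeneracy G.
Proof.
move=> S0; apply/exists_inP; apply: contraT; rewrite negb_exists_in.
move=> /forall_inP big_deg.
pose H : {set G} * {set G * G} :=
  (S, [set p | [&& p.1 \in S, p.2 \in S & adj p.1 p.2]]).
have subH : is_subgraph H && (H.1 != set0).
  rewrite S0 andbT; apply/forallP => u; apply/forallP => v; apply/implyP.
  by rewrite !inE /= => /and3P[-> -> uv]; rewrite uv adj_sym uv.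
have : subgraph_min_degree H <= degeneracy G by apply: leq_bigmax_cond.
rewrite leqNgt => /negP[].
rewrite /subgraph_min_degree.
apply: (big_ind (fun m => degeneracy G < m)) => [|m n dm dn|v vS].
- have /set0Pn[v /big_deg] := S0; rewrite -ltnNge => /leq_trans; apply.
  exact: max_card.
- by rewrite leq_min dm.
- move: (big_deg v vS); rewrite -ltnNge => /leq_trans; apply.
  apply: subset_leq_card; apply/subsetP => u; rewrite !inE /= => /andP[-> ->].
  by move: vS => /= ->.
Qed.

Lemma degeneracy_gt0 (G : sgraph) (u v : G) : adj u v -> 0 < degeneracy G.
Proof.
move=> uv; have [|w wS] := @exists_small_degree G [set u; v].
  by apply/set0Pn; exists u; rewrite !inE eqxx.
apply: leq_trans; apply/card_gt0P.
move: wS; rewrite !inE => /orP[] /eqP->.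
  by exists v; rewrite !inE eqxx orbT.
by exists u; rewrite !inE eqxx adj_sym.
Qed.

(** The [k] partial colourings of a packing, restricted to the vertices of [S]
    and recorded by their values: [c v i] is the colour of [v] in the [i]-th. *)
Definition partial_packing (G H : sgraph) (L : G -> {set H}) (k : nat)
    (S : {set G}) (c : G -> 'I_k -> H) : Prop :=
  [/\ forall v i, v \in S -> c v i \in L v,
      forall v, v \in S -> injective (c v) &
      forall u v i, u \in S -> v \in S -> ~~ adj (c u i) (c v i)].

Lemma extend_partial_packing (G H : sgraph) (L : G -> {set H}) (k : nat)
    (S : {set G}) (v : G) (c : G -> 'I_k -> H) :
    corr_cover L k -> v \notin S -> 2 * #|[set u in S | adj v u]| <= k ->
    partial_packing L S c ->
  exists c' : G -> 'I_k -> H, partial_packing L (v |: S) c'.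
Proof.
move=> cov vS few [cL cinj cind].
pose e (i : 'I_k) : H := enum_val (cast_ord (esym (cover_card cov v)) i).
have eL i : e i \in L v by apply: enum_valP.
have einj : injective e by move=> i j /enum_val_inj /cast_ord_inj.
have [||s sP] := @perm_avoiding_matchings G 'I_k [set u in S | adj v u]
  (fun u i j => adj (c u i) (e j)).
- by rewrite card_ord.
- move=> u i i' j j'; rewrite inE => /andP[uS vu] ij ij'.
  have uv : adj u v by rewrite adj_sym.
  have [xy yx] := cover_matching cov uv (cL u i uS) (cL u i' uS) (eL j) (eL j')
    ij ij'.
  split=> [ii'|jj'].
    by apply: einj; apply: xy; rewrite ii'.
  by apply: (cinj u uS); apply: yx; rewrite jj'.
have free u i : u \in S -> ~~ adj (c u i) (e (s i)).
  move=> uS; have [vu|nvu] := boolP (adj v u).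
    by apply: sP; rewrite inE uS.
  apply: (cover_nonadj cov (u := u) (v := v)) => //; last exact: cL.
    by apply: contraNneq vS => <-.
  by rewrite adj_sym.
exists (fun u i => if u == v then e (s i) else c u i); split.
- move=> u i; rewrite !inE; case: eqP => [->|_] //=; exact: cL.
- move=> u; rewrite !inE; case: eqP => [_ _ i j /einj /perm_inj //|_ /=].
  exact: cinj.
- move=> u w i; rewrite !inE.
  case: eqP => _ /= uS; case: eqP => _ /= wS.
  + by rewrite adj_irrefl.
  + by rewrite adj_sym free.
  + exact: free.
  + exact: cind.
Qed.

Lemma exists_partial_packing (G H : sgraph) (L : G -> {set H}) (k : nat)
    (S : {set G}) :
    corr_cover L k -> 2 * degeneracy G <= k ->
  exists c : G -> 'I_k -> H, partial_packing L S c.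
Proof.
move=> cov dk; have [n] := ubnP #|S|; elim: n S => // n IHn S.
have [->|S0] := eqVneq S set0.
  move=> _.
  (* Any function will do on the empty set; one exists since [L v] has
     [k] elements. *)
  exists (fun v i => enum_val (cast_ord (esym (cover_card cov v)) i)).
  by split=> [v i|v|u v i]; rewrite inE.
have [v vS few] := exists_small_degree S0.
rewrite (cardsD1 v) vS /= => /IHn[c cP].
rewrite -(setD1K vS); apply: extend_partial_packing cov _ _ cP.
  by rewrite !inE eqxx.
apply: leq_trans dk; rewrite leq_mul2l /=; apply: leq_trans few.
apply: subset_leq_card; apply/subsetP => u.
by rewrite !inE => /andP[/andP[_ ->] ->].
Qed.

Lemma packing_of_full_partial_packing (G H : sgraph) (L : G -> {set H})
    (k : nat) (c : G -> 'I_k -> H) :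
    corr_cover L k -> partial_packing L [set: G] c ->
  corr_packing L (fun i => [set c v i | v : G]).
Proof.
move=> cov [cL cinj cind].
have fibre u v i : c u i \in L v -> u = v.
  move=> cuv; apply/eqP; apply: contraT => uv.
  by have /disjointFr/(_ (cL u i (in_setT u))) := cover_disjoint cov uv; rewrite cuv.
split=> [i|i j ij].
  split=> [v|x y /imsetP[u _ ->] /imsetP[v _ ->]]; last exact: cind.
  apply/eqP/cards1P; exists (c v i); apply/setP => x; rewrite !inE.
  apply/andP/eqP => [[/imsetP[u _ ->] /fibre->] //|->].
  by split; [apply: imset_f | apply: cL].
rewrite -setI_eq0; apply/eqP/setP => x; rewrite !inE.
apply/negP => /andP[/imsetP[u _ ->] /imsetP[v _ cuv]].
have uv : u = v by apply: (fibre _ _ i); rewrite cuv cL.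
move: cuv; rewrite uv => /(cinj v (in_setT v)) /eqP.
by rewrite (negPf ij).
Qed.

Lemma corr_packable_double_degeneracy (G : sgraph) (k : nat) :
  2 * degeneracy G <= k -> corr_packable G k.
Proof.
move=> dk H L cov; have [c cP] := exists_partial_packing [set: G] cov dk.
by exists (fun i => [set c v i | v : G]); apply: packing_of_full_partial_packing.
Qed.

(** Packability quantifies over all covers and is not a boolean predicate,
    hence the classical case split. *)
Lemma packing_number_le (G : sgraph) (k : nat) :
    0 < k -> corr_packable G k ->
  exists m, is_corr_packing_number G m /\ m <= k.
Proof.
elim/ltn_ind: k => k IHk k0 kP.
have [[j [jk j0 jP]]|no_less] :=
    classic (exists j, [/\ j < k, 0 < j & corr_packable G j]).
  have [m [mP mj]] := IHk j jk j0 jP.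
  by exists m; split=> //; apply: leq_trans mj (ltnW jk).
exists k; split=> //; split=> // j j0 jP.
by rewrite leqNgt; apply/negP => jk; apply: no_less; exists j.
Qed.

Theorem theorem9 (G : sgraph) (has_edge : exists u v : G, adj u v) :
  exists k : nat, is_corr_packing_number G k /\ k <= 2 * degeneracy G.
Proof.
have [u [v uv]] := has_edge.
apply: packing_number_le; last exact: corr_packable_double_degeneracy.
by rewrite muln_gt0 (degeneracy_gt0 uv).
Qed.
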